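(* Let $q\le p$, let $\mathcal G:\mathbb R^q\to\mathbb R^p$ be a smooth mapping satisfying Assumption A1 (monotonicity, defined in the context) with matrix $Q\in\mathbb R^{q\times p}$, let $\phi:\mathbb R_{\ge 0}\to\mathbb R^p$ satisfy Assumption A2 (interval excitation, defined in the context), let $\theta\in\mathbb R^q$ be a constant vector, and let $$y(t)=\phi^\top(t)\,\mathcal G(\theta),\qquad t\ge 0 .$$ Let $\alpha>0$, $f_0>0$, $\beta_0>0$, $M\ge \frac1{f_0}$, $\gamma>0$ be tuning gains, and consider the estimator $$\dot{\hat\eta}(t)=\alpha F(t)\phi(t)\,[y(t)-\phi^\top(t)\hat\eta(t)],\qquad \hat\eta(0)=\eta_0\in\mathbb R^p,$$ $$\dot F(t)=-\alpha F(t)\phi(t)\phi^\top(t)F(t)+\beta(t)F(t),\qquad F(0)=\tfrac1{f_0}I_p,$$ $$\dot{\hat\theta}(t)=\gamma Q\,\Delta(t)\,[\mathcal Y(t)-\Delta(t)\mathcal G(\hat\theta(t))],\qquad \hat\theta(0)=\theta_0\in\mathbb R^q,$$ $$\dot z(t)=-\beta(t)z(t),\qquad z(0)=1,$$ where $$\beta(t):=\beta_0\Big(1-\frac{\|F(t)\|}{M}\Big),\qquad \Delta(t):=\det\{I_p-z(t)f_0F(t)\},$$ $$\mathcal Y(t):=\operatorname{adj}\{I_p-z(t)f_0F(t)\}\,[\hat\eta(t)-z(t)f_0F(t)\eta_0].$$ Then, for all $f_0>0$, $\eta_0\in\mathbb R^p$ and $\theta_0\in\mathbb R^q$, the parameter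 error $\tilde\theta(t):=\hat\theta(t)-\theta$ satisfies $\lim_{t\to\infty}\tilde\theta(t)=0$ exponentially, i.e. there exist constants $c,\lambda>0$ with $|\tilde\theta(t)|\le c\,e^{-\lambda t}$ for all $t\ge 0$, and all signals of the estimator ($\hat\eta$, $F$, $\hat\theta$, $z$, $\beta$, $\Delta$, $\mathcal Y$) are bounded on $[0,\infty)$.
   Context: $|\cdot|$ is the Euclidean norm, $\|\cdot\|$ the induced matrix norm, $I_n$ the $n\times n$ identity, $\operatorname{adj}$ the adjugate matrix; matrix inequalities are in the sense of symmetric (positive semidefinite) matrices. $\nabla\mathcal G(\theta)\in\mathbb R^{p\times q}$ denotes the Jacobian of $\mathcal G$ and $\nabla^\top\mathcal G(\theta)$ its transpose. The signal $\phi$ is assumed piecewise continuous so that the differential equations and integrals make sense. Assumption A1 (monotonicity): there exist a matrix $Q\in\mathbb R^{q\times p}$ and $\rho>0$ such that $$Q\nabla\mathcal G(\theta)+\nabla^\top\mathcal G(\theta)Q^\top\ge\rho I_q>0\qquad\text{for all }\theta\in\mathbb R^q .$$ Assumption A2 (interval excitation, IE): there exist constants $C_c>0$ and $t_c>0$ such that $\int_0^{t_c}\phi(s)\phi^\top(s)\,ds\ge C_c I_p$. *)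

(* Defs.v *)
(* MathComp / MathComp-Analysis, over an arbitrary realType R. *)
From HB Require Import structures.
From mathcomp Require Export all_boot all_order all_algebra.
From mathcomp Require Export all_classical all_reals all_analysis.
Export Order.TTheory GRing.Theory Num.Theory.
Export numFieldNormedType.Exports.

Set Implicit Arguments.
Unset Strict Implicit.
Unset Printing Implicit Defensive.

Local Open Scope classical_set_scope.
Local Open Scope ring_scope.

(* The library norm on matrices is the entrywise maximum, not the Euclidean
   norm. *)
Definition enorm (R : realType) (n : nat) (x : 'cV[R]_n) : R :=
  Num.sqrt (\sum_i x i 0 ^+ 2).

Definition opnorm (R : realType) (m n : nat) (A : 'M[R]_(m, n)) : R :=
  sup [set enorm (A *m x) | x in [set x : 'cV[R]_n | enorm x <= 1]].

Definition psdmx (R : realType) (n : nat) (A : 'M[R]_n) : Prop :=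
  A^T = A /\ forall x : 'cV[R]_n, 0 <= (x^T *m A *m x) 0 0.

Definition mxge (R : realType) (n : nat) (A B : 'M[R]_n) : Prop :=
  psdmx (A - B).

Fixpoint class_C (R : realType) (V W : normedModType R) (k : nat)
    (f : V -> W) : Prop :=
  match k with
  | 0%N => continuous f
  | k'.+1 => (forall x, differentiable f x) /\
             forall v, class_C k' (fun x => 'D_v f x)
  end.

Definition smooth (R : realType) (V W : normedModType R) (f : V -> W) : Prop :=
  forall k : nat, class_C k f.

(* Column-vector convention, entry (i, j) being the j-th partial derivative of
   the i-th component; the library's [jacobian] acts on row vectors and is the
   transpose of this matrix. *)
Definition jacobian_mx (R : realType) (p q : nat)
    (G : 'cV[R]_q -> 'cV[R]_p) (x : 'cV[R]_q) : 'M[R]_(p, q) :=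
  \matrix_(i, j) 'D_(delta_mx j 0) (fun u : 'cV[R]_q => G u i 0) x.

Definition monotonicity (R : realType) (p q : nat)
    (G : 'cV[R]_q -> 'cV[R]_p) (Q : 'M[R]_(q, p)) : Prop :=
  exists2 rho : R, 0 < rho &
    forall x : 'cV[R]_q,
      mxge (Q *m jacobian_mx G x + (jacobian_mx G x)^T *m Q^T) rho%:M.

(* Signals are functions on all of R of which only the restriction to
   [0, +oo[ matters. *)
Definition piecewise_continuous (R : realType) (W : normedModType R)
    (f : R -> W) : Prop :=
  [/\ forall T : R, exists s : seq R,
        forall t, 0 < t < T -> t \notin s -> {for t, continuous f},
      forall t, 0 <= t -> cvg (f u @[u --> t^'+]) &
      forall t, 0 < t -> cvg (f u @[u --> t^'-])].

Definition mx_integral (R : realType) (m n : nat) (A : R -> 'M[R]_(m, n))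
    (a b : R) : 'M[R]_(m, n) :=
  \matrix_(i, j) Rintegral (@lebesgue_measure R) `[a, b] (fun s => A s i j).

Definition interval_excitation (R : realType) (p : nat)
    (phi : R -> 'cV[R]_p) : Prop :=
  exists Cc tc : R, [/\ 0 < Cc, 0 < tc &
    mxge (mx_integral (fun s => phi s *m (phi s)^T) 0 tc) Cc%:M].

(* [x] solves x' = v, x(0) = x0 on [0, +oo[ ([v] being the right-hand side
   evaluated along the trajectory), where the right-hand side may jump at the
   discontinuities of the forcing signal [phi]: there [x] is only required to
   be continuous. *)
Definition solves_ode (R : realType) (U W : normedModType R) (phi : R -> U)
    (x v : R -> W) (x0 : W) : Prop :=
  [/\ x 0 = x0,
      {within `[0, +oo[, continuous x} &
      forall t, 0 < t -> {for t, continuous phi} -> is_derive t 1 x (v t)].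

Definition beta_gain (R : realType) (p : nat) (beta0 M : R)
    (F : R -> 'M[R]_p) (t : R) : R :=
  beta0 * (1 - opnorm (F t) / M).

Definition Delta_sig (R : realType) (p : nat) (f0 : R) (z : R -> R)
    (F : R -> 'M[R]_p) (t : R) : R :=
  \det (1%:M - (z t * f0) *: F t).

Definition Y_sig (R : realType) (p : nat) (f0 : R) (eta0 : 'cV[R]_p)
    (z : R -> R) (F : R -> 'M[R]_p) (etah : R -> 'cV[R]_p) (t : R) :
    'cV[R]_p :=
  \adj (1%:M - (z t * f0) *: F t) *m
    (etah t - (z t * f0) *: (F t *m eta0)).

(* F(t) is not assumed symmetric or invertible: both follow from its equation. *)
Record estimator_trajectory (R : realType) (p q : nat)
    (G : 'cV[R]_q -> 'cV[R]_p) (Q : 'M[R]_(q, p))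
    (phi : R -> 'cV[R]_p) (y : R -> R)
    (alpha f0 beta0 M gamma : R) (eta0 : 'cV[R]_p) (theta0 : 'cV[R]_q)
    (etah : R -> 'cV[R]_p) (F : R -> 'M[R]_p) (thetah : R -> 'cV[R]_q)
    (z : R -> R) : Prop := EstimatorTrajectory {
  etah_ode : solves_ode phi etah
    (fun t => alpha *: (F t *m phi t *m ((y t)%:M - (phi t)^T *m etah t)))
    eta0;
  F_ode : solves_ode phi F
    (fun t => - (alpha *: (F t *m phi t *m (phi t)^T *m F t))
              + beta_gain beta0 M F t *: F t)
    ((f0^-1)%:M);
  thetah_ode : solves_ode phi thetah
    (fun t => gamma *: (Q *m (Delta_sig f0 z F t *:
       (Y_sig f0 eta0 z F etah t - Delta_sig f0 z F t *: G (thetah t)))))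
    theta0;
  z_ode : solves_ode phi z (fun t => - (beta_gain beta0 M F t * z t)) 1
}.

Definition bounded_signal (R : realType) (W : normedModType R)
    (f : R -> W) : Prop :=
  [bounded f t | t in `[0, +oo[].

(* Main.v *)
Require Import Defs.
From mathcomp Require Import perm ring lra measurable_realfun.

(** Everything rests on the rescaled gain H = z F.  Multiplying by z cancels
    the forgetting term beta F and leaves H' = - alpha F phi phi^T H, which
    says that N = f0 I + alpha int_0^t phi phi^T / z is the inverse of H.
    This is proved without inverting anything: I - H N solves a linear
    equation from a zero initial condition, hence vanishes
    ([scaled_gain_infoE]).  The same equation governs
    etah - eta - f0 H (eta0 - eta), where eta = G theta, so this vanishes too
    ([etahE]); multiplying by the adjugate turns it into the scalar regression
    Y = Delta eta ([Y_sig_regression]).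

    Since N is nondecreasing in the Loewner order, the norm of H is
    nonincreasing, and a comparison argument on the scalar equation of z gives
    [opnorm (F t) <= M] ([opnorm_gain_leM]).  Then beta >= 0 and 0 < z <= 1.
    From 1 / z >= 1 and interval excitation, N >= f0 + alpha Cc after tc, so
    f0 H is a contraction with a uniform factor, |(I - f0 H) x| is at least a
    uniform multiple of |x|, and the determinant Delta stays away from 0
    ([Delta_excited]).

    Finally w = thetah - theta obeys
    w' = - gamma Delta^2 Q (G (theta + w) - G theta).  The monotonicity
    assumption integrates along segments to
    (rho / 2) |w|^2 <= w^T Q (G (theta + w) - G theta)
    ([monotone_increment]), so |w|^2 never increases and, after tc, decays at
    the rate gamma rho delta^2, where delta bounds |Delta| from below.

    The equations hold only at the continuity times of phi, which leave out
    finitely many times of each bounded interval.  All differential arguments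
    along trajectories therefore go through [pwderiv], which asks for
    continuity on [0, +oo[ and a derivative at the times of a set D; when D is
    cofinite in this sense, the sign of the derivative still controls the
    variations ([pwderiv_ge0_le]). *)

Set Implicit Arguments.
Unset Strict Implicit.
Unset Printing Implicit Defensive.

Local Open Scope classical_set_scope.
Local Open Scope ring_scope.

(** * Euclidean norm, operator norm and determinants *)

Section euclid.
Variable R : realType.

Definition dotmx n (u v : 'cV[R]_n) : R := (u^T *m v) 0 0.

Lemma dotmxE n (u v : 'cV[R]_n) : dotmx u v = \sum_i u i 0 * v i 0.
Proof. by rewrite /dotmx mxE; apply: eq_bigr => i _; rewrite mxE. Qed.

Lemma dotmxC n (u v : 'cV[R]_n) : dotmx u v = dotmx v u.
Proof. by rewrite !dotmxE; apply: eq_bigr => i _; rewrite mulrC. Qed.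

Lemma dotmxDr n (u v w : 'cV[R]_n) : dotmx u (v + w) = dotmx u v + dotmx u w.
Proof. by rewrite /dotmx mulmxDr mxE. Qed.

Lemma dotmxDl n (u v w : 'cV[R]_n) : dotmx (u + v) w = dotmx u w + dotmx v w.
Proof. by rewrite dotmxC dotmxDr !(dotmxC w). Qed.

Lemma dotmxZr n (c : R) (u v : 'cV[R]_n) : dotmx u (c *: v) = c * dotmx u v.
Proof. by rewrite /dotmx -scalemxAr mxE. Qed.

Lemma dotmxZl n (c : R) (u v : 'cV[R]_n) : dotmx (c *: u) v = c * dotmx u v.
Proof. by rewrite dotmxC dotmxZr dotmxC. Qed.

Lemma dotmxNr n (u v : 'cV[R]_n) : dotmx u (- v) = - dotmx u v.
Proof. by rewrite /dotmx mulmxN mxE. Qed.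

Lemma dotmx0r n (u : 'cV[R]_n) : dotmx u 0 = 0.
Proof. by rewrite /dotmx mulmx0 mxE. Qed.

Lemma dotmx_mulmx m n (A : 'M[R]_(m, n)) u v :
  dotmx u (A *m v) = dotmx (A^T *m u) v.
Proof. by rewrite /dotmx trmx_mul trmxK mulmxA. Qed.

Lemma dotmx_ge0 n (u : 'cV[R]_n) : 0 <= dotmx u u.
Proof. by rewrite dotmxE sumr_ge0// => i _; rewrite -expr2 sqr_ge0. Qed.

Lemma dotmx_eq0 n (u : 'cV[R]_n) : dotmx u u = 0 -> u = 0.
Proof.
rewrite dotmxE => /psumr_eq0P u0; apply/colP => i; rewrite mxE.
apply/eqP; rewrite -sqrf_eq0 expr2 u0// => j _.
by rewrite -expr2 sqr_ge0.
Qed.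

Lemma enorm_ge0 n (u : 'cV[R]_n) : 0 <= enorm u. Proof. exact: sqrtr_ge0. Qed.

Lemma enorm_sqr n (u : 'cV[R]_n) : enorm u ^+ 2 = dotmx u u.
Proof.
rewrite /enorm sqr_sqrtr ?dotmxE//.
by apply: sumr_ge0 => i _; exact: sqr_ge0.
Qed.

Lemma enorm_le n (u : 'cV[R]_n) (k : R) : 0 <= k ->
  dotmx u u <= k ^+ 2 -> enorm u <= k.
Proof. by move=> k0; rewrite -enorm_sqr ler_sqr ?nnegrE ?enorm_ge0. Qed.

Lemma enorm_eq0 n (u : 'cV[R]_n) : enorm u = 0 -> u = 0.
Proof. by move=> u0; apply: dotmx_eq0; rewrite -enorm_sqr u0 expr0n. Qed.

Lemma enorm0 n : enorm (0 : 'cV[R]_n) = 0.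
Proof.
by rewrite /enorm big1 ?sqrtr0// => i _; rewrite mxE expr0n.
Qed.

Lemma enormZ n (c : R) (u : 'cV[R]_n) : enorm (c *: u) = `|c| * enorm u.
Proof.
apply/eqP; rewrite -(@eqrXn2 _ 2) ?mulr_ge0 ?enorm_ge0 //.
by rewrite exprMn !enorm_sqr dotmxZl dotmxZr mulrA real_normK ?num_real// expr2.
Qed.

(** The form of P is nonnegative on s u + t v for every s and t; with
    s = u^T P v and t = - u^T P u this is the discriminant inequality times
    u^T P u. *)
Lemma psd_CauchySchwarz n (P : 'M[R]_n) (u v : 'cV[R]_n) : P^T = P ->
  (forall x, 0 <= dotmx x (P *m x)) ->
  dotmx u (P *m v) ^+ 2 <= dotmx u (P *m u) * dotmx v (P *m v).
Proof.
move=> PT P0.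
set a := dotmx u (P *m u); set b := dotmx u (P *m v); set c := dotmx v (P *m v).
have bE : dotmx v (P *m u) = b by rewrite dotmx_mulmx PT dotmxC.
have q s t : 0 <= s ^+ 2 * a + 2 * s * t * b + t ^+ 2 * c.
  have := P0 (s *: u + t *: v).
  rewrite mulmxDr -!scalemxAr !(dotmxDl, dotmxDr, dotmxZl, dotmxZr) bE -/a -/b -/c.
  congr (_ <= _); ring.
have a0 : 0 <= a by exact: P0.
have c0 : 0 <= c by exact: P0.
have q1 := q b (- a).
have [a_eq0|a_neq0] := eqVneq a 0.
  (* with a = 0 this choice gives - (c + 2) b^2 >= 0, so b = 0 *)
  have := q (- (c + 1)) b; rewrite a_eq0 => q3.
  have := sqr_ge0 b; nra.
have a_gt0 : 0 < a by rewrite lt0r a_neq0.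
rewrite -subr_ge0 -(pmulr_rge0 _ a_gt0); move: q1; congr (_ <= _); ring.
Qed.

Lemma CauchySchwarz n (u v : 'cV[R]_n) :
  dotmx u v ^+ 2 <= dotmx u u * dotmx v v.
Proof.
have := @psd_CauchySchwarz n 1%:M u v (trmx1 _ _).
by rewrite !mul1mx; apply => x; rewrite mul1mx dotmx_ge0.
Qed.

Lemma dotmx_le_enorm n (u v : 'cV[R]_n) : `|dotmx u v| <= enorm u * enorm v.
Proof.
rewrite -ler_sqr ?nnegrE ?mulr_ge0 ?enorm_ge0// real_normK ?num_real//.
by rewrite exprMn !enorm_sqr CauchySchwarz.
Qed.

Lemma enormD n (u v : 'cV[R]_n) : enorm (u + v) <= enorm u + enorm v.
Proof.
apply: enorm_le; first by rewrite addr_ge0 ?enorm_ge0.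
rewrite sqrrD !enorm_sqr !(dotmxDl, dotmxDr) (dotmxC v u).
have := ler_norm (dotmx u v); have := dotmx_le_enorm u v.
lra.
Qed.

Lemma normr_entry_le_enorm n (u : 'cV[R]_n) i : `|u i 0| <= enorm u.
Proof.
rewrite -ler_sqr ?nnegrE ?enorm_ge0// real_normK ?num_real// enorm_sqr dotmxE.
rewrite (bigD1 i)//= expr2 lerDl sumr_ge0// => j _.
by rewrite -expr2 sqr_ge0.
Qed.

(** Cauchy-Schwarz on each row.  It makes the set defining the operator norm
    bounded, and it bounds A by its entries. *)
Lemma mulmx_frobenius_le m n (A : 'M[R]_(m, n)) (x : 'cV[R]_n) :
  enorm (A *m x) <= Num.sqrt (\sum_i \sum_j A i j ^+ 2) * enorm x.
Proof.
apply: enorm_le; first by rewrite mulr_ge0 ?sqrtr_ge0 ?enorm_ge0.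
rewrite exprMn sqr_sqrtr; last first.
  by apply: sumr_ge0 => i _; apply: sumr_ge0 => j _; exact: sqr_ge0.
rewrite dotmxE mulr_suml; apply: ler_sum => i _.
have -> : (A *m x) i 0 = dotmx (row i A)^T x.
  by rewrite /dotmx trmxK -row_mul [RHS]mxE.
rewrite -expr2 (le_trans (CauchySchwarz _ _))// enorm_sqr ler_wpM2r ?dotmx_ge0//.
by rewrite dotmxE ler_sum// => j _; rewrite !mxE expr2.
Qed.

Lemma ubound_opnorm_set m n (A : 'M[R]_(m, n)) (k : R) : 0 <= k ->
  (forall x, enorm (A *m x) <= k * enorm x) ->
  ubound [set enorm (A *m x) | x in [set x : 'cV[R]_n | enorm x <= 1]] k.
Proof.
move=> k0 Ak _ [x /= x1 <-]; rewrite (le_trans (Ak x))//.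
by rewrite -[leRHS]mulr1 ler_wpM2l.
Qed.

Lemma opnorm_has_sup m n (A : 'M[R]_(m, n)) :
  has_sup [set enorm (A *m x) | x in [set x : 'cV[R]_n | enorm x <= 1]].
Proof.
split; first by exists (enorm (A *m 0)); exists 0 => //=; rewrite enorm0.
exists (Num.sqrt (\sum_i \sum_j A i j ^+ 2)).
by apply: ubound_opnorm_set; [exact: sqrtr_ge0|exact: mulmx_frobenius_le].
Qed.

Lemma opnorm_le m n (A : 'M[R]_(m, n)) (k : R) : 0 <= k ->
  (forall x, enorm (A *m x) <= k * enorm x) -> opnorm A <= k.
Proof.
move=> k0 Ak; apply: ge_sup; last exact: ubound_opnorm_set.
by have [] := opnorm_has_sup A.
Qed.

Lemma opnorm_ge0 m n (A : 'M[R]_(m, n)) : 0 <= opnorm A.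
Proof.
apply: (@le_trans _ _ (enorm (A *m 0))); first exact: enorm_ge0.
by apply: sup_ubound; [exact: (opnorm_has_sup A).2|exists 0 => //=; rewrite enorm0].
Qed.

Lemma mulmx_opnorm_le m n (A : 'M[R]_(m, n)) x :
  enorm (A *m x) <= opnorm A * enorm x.
Proof.
have [x0|x0] := eqVneq (enorm x) 0.
  by rewrite (enorm_eq0 x0) mulmx0 !enorm0 mulr0.
have x_gt0 : 0 < enorm x by rewrite lt0r x0 enorm_ge0.
have xi : 0 <= (enorm x)^-1 by rewrite invr_ge0 enorm_ge0.
rewrite -ler_pdivrMr// mulrC -(ger0_norm xi) -enormZ scalemxAr.
apply: sup_ubound; first exact: (opnorm_has_sup A).2.
by exists ((enorm x)^-1 *: x) => //=; rewrite enormZ ger0_norm// mulVf.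
Qed.

Lemma normr_entry_le_opnorm m n (A : 'M[R]_(m, n)) i j : `|A i j| <= opnorm A.
Proof.
have := mulmx_opnorm_le A (delta_mx j 0); rewrite -colE.
have -> : enorm (delta_mx j 0 : 'cV[R]_n) = 1.
  apply/eqP; rewrite -(@eqrXn2 _ 2) ?enorm_ge0//.
  rewrite enorm_sqr dotmxE (bigD1 j)//= big1 ?mxE ?eqxx ?mulr1 ?addr0 ?expr1n//.
  by move=> k kj; rewrite !mxE (negbTE kj) mul0r.
rewrite mulr1; apply: le_trans.
by have := normr_entry_le_enorm (col j A) i; rewrite mxE.
Qed.

Lemma opnormZ m n (c : R) (A : 'M[R]_(m, n)) : 0 < c ->
  opnorm (c *: A) = c * opnorm A.
Proof.
move=> c0; apply/eqP; rewrite eq_le; apply/andP; split.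
  apply: opnorm_le => [|x]; first by rewrite mulr_ge0 ?opnorm_ge0 ?ltW.
  rewrite -scalemxAl enormZ gtr0_norm// -mulrA.
  by apply: ler_wpM2l; [exact: ltW|exact: mulmx_opnorm_le].
rewrite mulrC -ler_pdivlMr//; apply: opnorm_le => [|x].
  by rewrite divr_ge0 ?opnorm_ge0 ?ltW.
rewrite mulrAC ler_pdivlMr//.
have := mulmx_opnorm_le (c *: A) x.
by rewrite -scalemxAl enormZ gtr0_norm// mulrC.
Qed.

Lemma normr_det_le n (A : 'M[R]_n) (k : R) :
  (forall i j, `|A i j| <= k) -> `|\det A| <= n`!%:R * k ^+ n.
Proof.
move=> Ak; rewrite /determinant (le_trans (ler_norm_sum _ _ _))//.
apply: (@le_trans _ _ (\sum_(s : 'S_n) k ^+ n)).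
  apply: ler_sum => s _; rewrite normrM normrX normrN1 expr1n mul1r.
  rewrite normr_prod -[X in _ <= _ ^+ X]card_ord -prodr_const.
  by apply: ler_prod => i _; rewrite normr_ge0 Ak.
by rewrite sumr_const card_Sn mulr_natl.
Qed.

(** The inverse of A has entries bounded by 1 / k, and so a determinant bounded
    by n! / k ^ n through the Leibniz formula.  This is cruder than the bound
    k ^ n given by the singular values, but it needs no decomposition. *)
Lemma det_bounded_below_ge n (A : 'M[R]_n) (k : R) : 0 < k ->
  (forall x, k * enorm x <= enorm (A *m x)) -> k ^+ n / n`!%:R <= `|\det A|.
Proof.
move=> k0 Ak.
have kn0 : 0 < k ^+ n by rewrite exprn_gt0.
have n0 : 0 < n`!%:R :> R by rewrite ltr0n fact_gt0.
have Au : A \in unitmx.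
  rewrite unitmxE unitfE -det_tr; apply/negP => /det0P[v v0 vA].
  move/negP: v0; apply; apply/eqP; rewrite -[v]trmxK.
  have Av : A *m v^T = 0 by rewrite -[A]trmxK -trmx_mul vA trmx0.
  have := Ak v^T; rewrite Av enorm0 pmulr_rle0// => v0.
  rewrite (@enorm_eq0 _ v^T) ?trmx0//.
  by apply/eqP; rewrite eq_le v0 enorm_ge0.
have Ai : opnorm (invmx A) <= k^-1.
  apply: opnorm_le => [|x]; first by rewrite invr_ge0 ltW.
  by rewrite ler_pdivlMl// (le_trans (Ak _))// mulKVmx.
have := @normr_det_le n (invmx A) k^-1.
rewrite det_inv normfV => /(_ (fun i j => le_trans (normr_entry_le_opnorm _ i j) Ai)).
have d0 : 0 < `|\det A| by rewrite normr_gt0 -unitfE -unitmxE.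
rewrite exprVn -[in X in X -> _](invrK (_ / _)) invf_div.
by rewrite lef_pV2 ?posrE// divr_gt0.
Qed.

(** The smallest eigenvalue of N is the inverse of the norm of H.  Without
    eigenvalues, this is Cauchy-Schwarz for the form of N, applied to x and
    H x, which satisfies N (H x) = x. *)
Lemma sqnorm_le_opnorm_inv_form n (N H : 'M[R]_n) (x : 'cV[R]_n) : N^T = N ->
  (forall x, 0 <= dotmx x (N *m x)) -> N *m H = 1%:M ->
  dotmx x x <= opnorm H * dotmx x (N *m x).
Proof.
move=> NT N0 NH.
have := psd_CauchySchwarz x (H *m x) NT N0.
rewrite mulmxA NH mul1mx => cs.
have Hx : dotmx (H *m x) x <= opnorm H * dotmx x x.
  rewrite (le_trans (ler_norm _))// (le_trans (dotmx_le_enorm _ _))//.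
  by rewrite -enorm_sqr expr2 mulrA ler_wpM2r ?enorm_ge0// mulmx_opnorm_le.
have [x0|x0] := eqVneq (dotmx x x) 0.
  by rewrite x0 mulr_ge0// opnorm_ge0.
have x_gt0 : 0 < dotmx x x by rewrite lt0r x0 dotmx_ge0.
rewrite -(ler_pM2l x_gt0) -expr2 (le_trans cs)// mulrCA mulrC.
by rewrite mulrA ler_wpM2r.
Qed.

Lemma coercive_inv_enorm_le n (N H : 'M[R]_n) (h : R) : 0 <= h ->
  (forall x, dotmx x x <= h * dotmx x (N *m x)) -> N *m H = 1%:M ->
  forall y, enorm (H *m y) <= h * enorm y.
Proof.
move=> h0 Nh NH y; set x := H *m y.
have [x0|x0] := eqVneq (enorm x) 0; first by rewrite x0 mulr_ge0 ?enorm_ge0.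
have x_gt0 : 0 < enorm x by rewrite lt0r x0 enorm_ge0.
rewrite -(ler_pM2l x_gt0) -expr2 enorm_sqr (le_trans (Nh x))//.
rewrite mulrCA ler_wpM2l//.
have -> : N *m x = y by rewrite mulmxA NH mul1mx.
by rewrite (le_trans (ler_norm _))// dotmx_le_enorm.
Qed.

End euclid.

Lemma normr_entry_le_mx_norm (R : realType) m n (A : 'M[R]_(m, n)) i j :
  `|A i j| <= `|A|.
Proof.
rewrite [leRHS]/Num.Def.normr/= mx_normrE.
exact: (le_bigmax _ (fun ij : 'I_m * 'I_n => `|A ij.1 ij.2|) (i, j)).
Qed.

Lemma mx_norm_le_entry (R : realType) m n (A : 'M[R]_(m, n)) (k : R) : 0 <= k ->
  (forall i j, `|A i j| <= k) -> `|A| <= k.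
Proof.
move=> k0 Ak; rewrite [leLHS]/Num.Def.normr/= mx_normrE.
by apply: bigmax_le => // -[i j] _; exact: Ak.
Qed.

(** * Piecewise differentiable signals *)

Definition locally_bounded (R : realType) (f : R -> R) :=
  forall T : R, exists C : R, forall t, 0 <= t <= T -> `|f t| <= C.

(** Induction on the list of exceptional times: an exceptional time inside
    ]a, b[ cuts the interval in two, and the mean value theorem applies when
    none is left. *)
Lemma derivable_ge0_le (R : realType) (f f' : R -> R) (s : seq R) (a b : R) :
  a <= b -> {within `[a, b], continuous f} ->
  (forall t, a < t < b -> t \notin s -> is_derive t 1 f (f' t) /\ 0 <= f' t) ->
  f a <= f b.
Proof.
elim: s a b => [|c s IH] a b ab cf df.
  move: ab; rewrite le_eqVlt => /predU1P[->//|ab].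
  have dab u : u \in `]a, b[%R -> is_derive u 1 f (f' u).
    by rewrite in_itv/= => uab; exact: (df u uab isT).1.
  have [t' t'ab fab'] := MVT ab dab cf.
  rewrite -subr_ge0 fab' mulr_ge0// ?subr_ge0 ?(ltW ab)//.
  by move: t'ab; rewrite in_itv/= => /df/(_ isT)[].
have [/andP[ac cb]|cab] := boolP (a < c < b); last first.
  apply: IH => // t tab ts; apply: df => //.
  by rewrite inE negb_or ts andbT; apply: contra cab => /eqP <-.
apply: (@le_trans _ _ (f c)); apply: IH; try exact: ltW.
- apply: continuous_subspaceW cf; apply: subset_itvl.
  by rewrite bnd_simp ltW.
- move=> t /andP[ta tc] ts; apply: df; first by rewrite ta (lt_trans tc).
  by rewrite inE negb_or ts andbT lt_eqF.
- apply: continuous_subspaceW cf; apply: subset_itvr.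
  by rewrite bnd_simp ltW.
- move=> t /andP[ta tc] ts; apply: df; first by rewrite (lt_trans ac).
  by rewrite inE negb_or ts andbT gt_eqF.
Qed.

Definition cofinite_times (R : realType) (D : set R) :=
  forall T : R, exists s : seq R, forall t, 0 < t < T -> t \notin s -> D t.

(** The notion of solution of a differential equation whose right-hand side
    may jump outside of D. *)
Definition pwderiv (R : realType) (D : set R) (f f' : R -> R) :=
  {within `[0, +oo[, continuous f} /\
  forall t, 0 < t -> D t -> is_derive t 1 f (f' t).

Section pwderiv_theory.
Variables (R : realType) (D : set R).
Implicit Types f g : R -> R.

Lemma pwderiv_eq f f' g g' : f =1 g -> (forall t, 0 < t -> D t -> f' t = g' t) ->
  pwderiv D f f' -> pwderiv D g g'.
Proof.
move=> /funext <- fg' [cf df]; split=> // t t0 Dt.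
by rewrite -fg'//; exact: df.
Qed.

Lemma pwderiv_eqd f f' g' : (forall t, 0 < t -> D t -> f' t = g' t) ->
  pwderiv D f f' -> pwderiv D f g'.
Proof. exact: pwderiv_eq. Qed.

Lemma pwderiv_cst c : pwderiv D (fun=> c) (fun=> 0).
Proof. by split; [move=> x; exact: cvg_cst | move=> *; exact: is_derive_cst]. Qed.

Lemma pwderivD f f' g g' : pwderiv D f f' -> pwderiv D g g' ->
  pwderiv D (fun t => f t + g t) (fun t => f' t + g' t).
Proof.
move=> [cf df] [cg dg]; split=> [x|t t0 Dt]; first exact: cvgD (cf x) (cg x).
by apply: is_deriveD; [exact: df|exact: dg].
Qed.

Lemma pwderivN f f' : pwderiv D f f' ->
  pwderiv D (fun t => - f t) (fun t => - f' t).
Proof.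
move=> [cf df]; split=> [x|t t0 Dt]; first exact: cvgN (cf x).
by apply: is_deriveN; exact: df.
Qed.

Lemma pwderivM f f' g g' : pwderiv D f f' -> pwderiv D g g' ->
  pwderiv D (fun t => f t * g t) (fun t => f' t * g t + f t * g' t).
Proof.
move=> [cf df] [cg dg]; split=> [x|t t0 Dt]; first exact: cvgM (cf x) (cg x).
apply: is_derive_eq; first by apply: is_deriveM; [exact: df|exact: dg].
by rewrite /GRing.scale/= addrC [g t * _]mulrC.
Qed.

Lemma pwderiv_sum (I : Type) (r : seq I) (f f' : I -> R -> R) :
  (forall i, pwderiv D (f i) (f' i)) ->
  pwderiv D (fun t => \sum_(i <- r) f i t) (fun t => \sum_(i <- r) f' i t).
Proof.
move=> df; elim: r => [|i r IH].
  apply: pwderiv_eq (pwderiv_cst 0) => [t|t _ _]; by rewrite big_nil.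
by apply: pwderiv_eq (pwderivD (df i) IH) => [t|t _ _]; rewrite big_cons.
Qed.

Lemma pwderiv_expR c :
  pwderiv D (fun t => expR (c * t)) (fun t => c * expR (c * t)).
Proof.
split=> [|t _ _].
  apply: continuous_subspaceT => x.
  apply: (@continuous_comp _ _ _ ( *%R c) expR); first exact: mulrl_continuous.
  exact: continuous_expR.
rewrite mulrC.
have H : is_derive t 1 ( *%R c) c.
  apply: is_derive_eq (is_deriveZ c (is_derive_id t (1:R))) _.
  by rewrite /GRing.scale/= mulr1.
exact: (is_derive1_comp (f := expR) (g := *%R c)).
Qed.

Lemma pwderiv_ge0_le f f' a b : cofinite_times D -> pwderiv D f f' ->
  0 <= a -> a <= b -> (forall t, a < t < b -> D t -> 0 <= f' t) -> f a <= f b.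
Proof.
move=> /(_ b)[s Ds] [cf df] a0 ab f'0.
apply: (@derivable_ge0_le _ f f' s) => //.
  apply: continuous_subspaceW cf => t /=; rewrite !in_itv/= andbT => /andP[+ _].
  exact: le_trans.
move=> t /andP[at_ tb] ts; have t0 : 0 < t by exact: le_lt_trans at_.
by split; [apply: df => //|apply: f'0; rewrite ?at_//]; apply: Ds; rewrite ?t0.
Qed.

Lemma pwderiv_le0_ge f f' a b : cofinite_times D -> pwderiv D f f' ->
  0 <= a -> a <= b -> (forall t, a < t < b -> D t -> f' t <= 0) -> f b <= f a.
Proof.
move=> cD df a0 ab f'0; rewrite -lerN2.
apply: (pwderiv_ge0_le cD (pwderivN df) a0 ab) => t tab Dt.
by rewrite oppr_ge0 f'0.
Qed.

Lemma pwderiv_bounded f f' : pwderiv D f f' -> locally_bounded f.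
Proof.
move=> [cf _] T.
have cT : {within `[0, T], continuous f}.
  by apply: continuous_subspaceW cf; exact: subset_itvl.
have [M [_ HM]] := compact_bounded (continuous_compact cT (@segment_compact _ 0 T)).
exists (M + 1) => t t0T; apply: HM; first by rewrite ltrDl.
by exists t.
Qed.

End pwderiv_theory.

Lemma is_derive_entry (R : realType) n m (A : R -> 'M[R]_(n, m)) (A' : 'M[R]_(n, m))
    (s : R) i j :
  is_derive s (1 : R) A A' -> is_derive s (1 : R) (fun s => A s i j) (A' i j).
Proof.
move=> [Ad Av]; apply: DeriveDef.
  exact: ((derivable_mxP A s 1).1 Ad i j).
by rewrite -Av derive_mx// mxE.
Qed.

(** Entrywise, so that the rules for products and sums reduce to the scalar
    ones. *)
Definition mpwderiv (R : realType) (D : set R) m n (A A' : R -> 'M[R]_(m, n)) :=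
  forall i j, pwderiv D (fun t => A t i j) (fun t => A' t i j).

Section mpwderiv_theory.
Variables (R : realType) (D : set R).

Lemma mpwderiv_eq m n (A A' B B' : R -> 'M[R]_(m, n)) :
  (forall t, A t = B t) -> (forall t, 0 < t -> D t -> A' t = B' t) ->
  mpwderiv D A A' -> mpwderiv D B B'.
Proof.
move=> AB AB' dA i j; apply: pwderiv_eq (dA i j) => [t|t t0 Dt].
  by rewrite AB.
by rewrite AB'.
Qed.

Lemma mpwderiv_cst m n (A : 'M[R]_(m, n)) : mpwderiv D (fun=> A) (fun=> 0).
Proof.
by move=> i j; apply: pwderiv_eqd (pwderiv_cst _ _) => t _ _; rewrite mxE.
Qed.

Lemma mpwderivD m n (A A' B B' : R -> 'M[R]_(m, n)) :
  mpwderiv D A A' -> mpwderiv D B B' ->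
  mpwderiv D (fun t => A t + B t) (fun t => A' t + B' t).
Proof.
move=> dA dB i j; apply: pwderiv_eq (pwderivD (dA i j) (dB i j)) => [t|t _ _];
  by rewrite mxE.
Qed.

Lemma mpwderivN m n (A A' : R -> 'M[R]_(m, n)) :
  mpwderiv D A A' -> mpwderiv D (fun t => - A t) (fun t => - A' t).
Proof.
move=> dA i j; apply: pwderiv_eq (pwderivN (dA i j)) => [t|t _ _];
  by rewrite mxE.
Qed.

Lemma mpwderivZ m n (f f' : R -> R) (A A' : R -> 'M[R]_(m, n)) :
  pwderiv D f f' -> mpwderiv D A A' ->
  mpwderiv D (fun t => f t *: A t) (fun t => f' t *: A t + f t *: A' t).
Proof.
move=> df dA i j; apply: pwderiv_eq (pwderivM df (dA i j)) => [t|t _ _];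
  by rewrite !mxE.
Qed.

Lemma mpwderivM m n p (A A' : R -> 'M[R]_(m, n)) (B B' : R -> 'M[R]_(n, p)) :
  mpwderiv D A A' -> mpwderiv D B B' ->
  mpwderiv D (fun t => A t *m B t) (fun t => A' t *m B t + A t *m B' t).
Proof.
move=> dA dB i j.
apply: pwderiv_eq (pwderiv_sum (index_enum _)
  (fun k => pwderivM (dA i k) (dB k j))) => [t|t _ _].
  by rewrite mxE.
by rewrite !mxE -big_split.
Qed.

Lemma mpwderivT m n (A A' : R -> 'M[R]_(m, n)) :
  mpwderiv D A A' -> mpwderiv D (fun t => (A t)^T) (fun t => (A' t)^T).
Proof.
move=> dA i j; apply: pwderiv_eq (dA j i) => [t|t _ _]; by rewrite mxE.
Qed.

Lemma continuous_mpwderiv m n (A A' : R -> 'M[R]_(m, n)) :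
  {within `[0, +oo[, continuous A} ->
  (forall t, 0 < t -> D t -> is_derive t 1 A (A' t)) -> mpwderiv D A A'.
Proof.
move=> cA dA i j; split=> [t|t t0 Dt].
  apply: (@continuous_comp (subspace _) _ _ A (fun M : 'M[R]_(m, n) => M i j) t
    (cA t)).
  exact: coord_continuous.
by apply: is_derive_entry; exact: dA.
Qed.

End mpwderiv_theory.

(** * Local boundedness and integrals of piecewise continuous signals *)

Section locally_bounded_theory.
Variable R : realType.
Implicit Types f g : R -> R.

Lemma locally_bounded_cst c : locally_bounded (fun=> c : R).
Proof. by move=> T; exists `|c|. Qed.

Lemma locally_boundedD f g : locally_bounded f -> locally_bounded g ->
  locally_bounded (fun t => f t + g t).
Proof.
move=> bf bg T; have [C fC] := bf T; have [E gE] := bg T.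
exists (C + E) => t tT; rewrite (le_trans (ler_normD _ _))//.
by rewrite lerD ?fC ?gE.
Qed.

Lemma locally_boundedM f g : locally_bounded f -> locally_bounded g ->
  locally_bounded (fun t => f t * g t).
Proof.
move=> bf bg T; have [C fC] := bf T; have [E gE] := bg T.
by exists (C * E) => t tT; rewrite normrM ler_pM ?fC ?gE.
Qed.

Lemma locally_bounded_sum (I : Type) (r : seq I) (f : I -> R -> R) :
  (forall i, locally_bounded (f i)) ->
  locally_bounded (fun t => \sum_(i <- r) f i t).
Proof.
move=> bf; elim: r => [|i r IH] T.
  by exists 0 => t _; rewrite big_nil normr0.
have [C fC] := locally_boundedD (bf i) IH T.
by exists C => t tT; rewrite big_cons fC.
Qed.

Lemma locally_bounded_mulmx m n k (A : R -> 'M[R]_(m, n)) (B : R -> 'M[R]_(n, k)) :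
  (forall i j, locally_bounded (fun t => A t i j)) ->
  (forall i j, locally_bounded (fun t => B t i j)) ->
  forall i j, locally_bounded (fun t => (A t *m B t) i j).
Proof.
move=> bA bB i j T.
have [C hC] := @locally_bounded_sum _ (index_enum 'I_n) _
  (fun l => locally_boundedM (bA i l) (bB l j)) T.
by exists C => t tT; rewrite mxE hC.
Qed.

End locally_bounded_theory.

(** Near each point the signal is bounded by its two one-sided limits and its
    value there, and [0, T] is compact.  At t = 0 there is no left limit, hence
    the restriction to nonnegative times in the covered property. *)
Lemma piecewise_continuous_bounded (R : realType) (W : normedModType R)
  (f : R -> W) (T : R) : piecewise_continuous f ->
  exists C : R, forall t, 0 <= t <= T -> `|f t| <= C.
Proof.
move=> [_ fr fl].
pose P (C : R) (t : R) := 0 <= t -> `|f t| <= C.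
have nc := (compact_near_coveringP _).1 (@segment_compact R 0 T).
have bnd (F : set_system R) : ProperFilter F -> cvg (f @ F) ->
    exists C : R, \forall u \near F, `|f u| <= C.
  move=> FF /cvg_ex[l fl']; exists (`|l| + 1).
  have lt1 : `|l| < `|l| + 1 by rewrite ltrDl ltr01.
  exact: (@cvgr_norm_le _ _ _ _ _ _ _ fl' _ lt1).
have : \forall C \near (+oo : set_system R), `[0, T] `<=` P C.
  apply: nc => t; rewrite /= in_itv/= => /andP[t0 tT].
  have [Cr hr] : exists C : R, \forall u \near t^'+, `|f u| <= C.
    exact: bnd (fr t t0).
  have [Cl hl] : exists C : R, \forall u \near t^'-, 0 <= u -> `|f u| <= C.
    move: (t0); rewrite le_eqVlt => /predU1P[<-|t_gt0].
      exists 0; near=> u => u0; exfalso.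
      have : u < 0 by near: u; exact: nbhs_left_lt.
      by rewrite ltNge u0.
    by have [C hC] := bnd _ _ (fl t t_gt0); exists C; apply: filterS hC.
  exists ([set u | 0 <= u -> `|f u| <= Num.max (Num.max Cr Cl) `|f t|],
          [set C | Num.max (Num.max Cr Cl) `|f t| <= C]).
    split=> /=; last by apply: nbhs_pinfty_ge; exact: num_real.
    move: hr hl; rewrite !near_withinE => hr hl.
    near=> u => u0.
    have [ut|tu|->] := ltgtP u t.
    - by rewrite !le_max (near hl u)// orbT.
    - by rewrite !le_max (near hr u).
    - by rewrite le_max lexx orbT.
  by move=> [u C]/= [hu hC] u0; exact: le_trans (hu u0) hC.
move=> [C [_ hC]]; exists (C + 1) => t t0T.
have C1 : C < C + 1 by rewrite ltrDl.
have := hC _ C1 t; rewrite /P/= in_itv/= t0T.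
by apply=> //; case/andP: t0T.
Unshelve. all: by end_near. Qed.

Section pw_integral.
Variables (R : realType) (D : set R).

Lemma measurable_fun_cofinite_continuous (f : R -> R) (s : seq R) (a b : R) :
  (forall t, a < t < b -> t \notin s -> {for t, continuous f}) ->
  measurable_fun `]a, b[ f.
Proof.
elim: s a b => [|c s IH] a b cf.
  apply: subspace_continuous_measurable_fun; first exact: measurable_itv.
  apply: continuous_in_subspaceT => t; rewrite inE/= in_itv/= => tab.
  exact: cf.
have [/andP[ac cb]|cab] := boolP (a < c < b); last first.
  apply: IH => // t tab ts; apply: cf => //.
  by rewrite inE negb_or ts andbT; apply: contra cab => /eqP <-.
rewrite (@itv_bndbnd_setU _ _ _ (BLeft c)) ?bnd_simp//; last exact: ltW.
rewrite -(@setU1itv _ _ _ _ false) ?bnd_simp//.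
apply/measurable_funU => //; first exact: measurableU.
split; last (apply/measurable_funU => //; split; first exact: measurable_fun_set1).
- apply: IH => t /andP[ta tc] ts; apply: cf; first by rewrite ta (lt_trans tc).
  by rewrite inE negb_or ts andbT lt_eqF.
- apply: IH => t /andP[ta tc] ts; apply: cf; first by rewrite (lt_trans ac).
  by rewrite inE negb_or ts andbT gt_eqF.
Qed.

Hypothesis cD : cofinite_times D.
Variable f : R -> R.
Hypothesis fD : forall t, 0 < t -> D t -> {for t, continuous f}.
Hypothesis fbnd : locally_bounded f.

Lemma pw_integrable T : 0 < T ->
  (@lebesgue_measure R).-integrable `[0, T] (EFin \o f).
Proof.
move=> T0; apply: measurable_bounded_integrable => //=.
- by rewrite lebesgue_measure_itv/= lte_fin T0 -EFinD ltry.
- rewrite -(@setU1itv _ _ _ _ false) ?bnd_simp//; last exact: ltW.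
  rewrite -(@setUitv1 _ _ _ _ true) ?bnd_simp//.
  apply/measurable_funU => //; first exact: measurableU.
  split; first exact: measurable_fun_set1.
  apply/measurable_funU => //; split; last exact: measurable_fun_set1.
  have [s sD] := cD T.
  apply: (@measurable_fun_cofinite_continuous f s) => t /andP[t0 tT] ts.
  by apply: fD => //; apply: sD => //; rewrite t0.
- have [C fC] := fbnd T; exists C; split=> [|x Cx t/=]; first exact: num_real.
  by rewrite in_itv/= => t0T; rewrite (le_trans (fC _ t0T))// ltW.
Qed.

(** Fundamental theorem of calculus for a signal that may jump outside of D. *)
Lemma pwderiv_integral :
  pwderiv D (fun t => Rintegral (@lebesgue_measure R) `[0, t] f) f.
Proof.
split.
  have cT T : 0 < T -> {within `[0, T], continuous
      (fun t => Rintegral (@lebesgue_measure R) `[0, t] f)}.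
    move=> T0; apply: parameterized_integral_continuous; first exact: ltW.
    exact: pw_integrable.
  apply/continuous_within_itvcyP; split.
    move=> t; rewrite in_itv/= andbT => t0.
    have t1 : 0 < t + 1 by rewrite addr_gt0.
    have /(continuous_within_itvP _ t1)[cc _ _] := cT _ t1.
    by apply: cc; rewrite in_itv/= t0 ltrDl ltr01.
  have /(continuous_within_itvP _ ltr01)[_ c0 _] := cT 1 ltr01.
  exact: c0.
move=> t t0 Dt.
have t1 : t < t + 1 by rewrite ltrDl.
have [d1 d2] := continuous_FTC1_closed t1
  (pw_integrable (lt_trans t0 t1)) t0 (fD t0 Dt).
by apply: DeriveDef => //; rewrite -derive1E.
Qed.

End pw_integral.

(** * Uniqueness for linear equations *)

Section linear_ode.
Variables (R : realType) (D : set R).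
Hypothesis cD : cofinite_times D.

Lemma pwderiv_sqnorm n (w w' : R -> 'cV[R]_n) : mpwderiv D w w' ->
  pwderiv D (fun t => dotmx (w t) (w t)) (fun t => 2 * dotmx (w t) (w' t)).
Proof.
move=> dw; apply: pwderiv_eqd (mpwderivM (mpwderivT dw) dw 0 0) => t _ _.
by rewrite mxE -/(dotmx _ _) -/(dotmx _ _) dotmxC mulr_natl mulr2n.
Qed.

(** Gronwall: if L bounds the norm of B on [0, T], then |w|^2 exp(- 2 L t) is
    nonincreasing there, and it starts at 0. *)
Lemma linear_cV_ode_eq0 n (B : R -> 'M[R]_n) (w : R -> 'cV[R]_n) :
  (forall i j, locally_bounded (fun t => B t i j)) ->
  mpwderiv D w (fun t => B t *m w t) -> w 0 = 0 -> forall t, 0 <= t -> w t = 0.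
Proof.
move=> bB dw w0 T T0; apply: dotmx_eq0; apply/eqP.
rewrite eq_le dotmx_ge0 andbT.
have [C hC] := @locally_bounded_sum _ _ (index_enum 'I_n) _ (fun i =>
  @locally_bounded_sum _ _ (index_enum 'I_n) _ (fun j =>
  locally_boundedM (bB i j) (bB i j))) T.
set L := Num.sqrt C.
have BL t : 0 <= t <= T -> enorm (B t *m w t) <= L * enorm (w t).
  move=> tT; rewrite (le_trans (mulmx_frobenius_le _ _))//.
  rewrite ler_wpM2r ?enorm_ge0// ler_wsqrtr//.
  by apply: le_trans (hC t tT); rewrite ler_norm.
have dV := pwderivM (pwderiv_sqnorm dw) (pwderiv_expR D (- (2 * L))).
have : dotmx (w T) (w T) * expR (- (2 * L) * T) <= 0.
  have -> : 0 = dotmx (w 0) (w 0) * expR (- (2 * L) * 0).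
    by rewrite w0 dotmx0r mul0r.
  apply: (pwderiv_le0_ge cD dV) => // t /andP[t0 tT] Dt.
  rewrite mulrA -mulrDl pmulr_lle0 ?expR_gt0//.
  have tT' : 0 <= t <= T by rewrite !ltW.
  have := le_trans (ler_norm _) (dotmx_le_enorm (w t) (B t *m w t)).
  have := ler_wpM2l (enorm_ge0 (w t)) (BL t tT').
  have := enorm_sqr (w t).
  set e := enorm _ in BL *; move=> <-; lra.
by rewrite pmulr_lle0// expR_gt0.
Qed.

Lemma linear_ode_eq0 n m (B : R -> 'M[R]_n) (w : R -> 'M[R]_(n, m)) :
  (forall i j, locally_bounded (fun t => B t i j)) ->
  mpwderiv D w (fun t => B t *m w t) -> w 0 = 0 -> forall t, 0 <= t -> w t = 0.
Proof.
move=> bB dw w0 t t0; apply/matrixP => i j; rewrite mxE.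
have dwj : mpwderiv D (fun t => col j (w t)) (fun t => B t *m col j (w t)).
  move=> k l; apply: pwderiv_eq (dw k j) => [s|s _ _]; first by rewrite mxE.
  by rewrite !mxE; apply: eq_bigr => a _; rewrite mxE.
have wj0 : col j (w 0) = 0 by rewrite w0; apply/colP => k; rewrite !mxE.
have := linear_cV_ode_eq0 bB dwj wj0 t0.
by move=> /colP/(_ i); rewrite !mxE.
Qed.

End linear_ode.

(** * Strongly monotone maps *)

Section monotone_map.
Variables (R : realType) (p q : nat).
Variables (G : 'cV[R]_q -> 'cV[R]_p) (Q : 'M[R]_(q, p)).
Hypothesis dG : forall x, differentiable G x.

Lemma derive_jacobian_mx (x v : 'cV[R]_q) : 'D_v G x = jacobian_mx G x *m v.
Proof.
have vE : v = \sum_j v j 0 *: (delta_mx j 0 : 'cV[R]_q).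
  rewrite [LHS]matrix_sum_delta; apply: eq_bigr => j _.
  by rewrite big_ord1.
rewrite deriveE// [in LHS]vE linear_sum.
apply/colP => i; rewrite mxE summxE; apply: eq_bigr => j _.
rewrite linearZ/= mxE -deriveE// mxE mulrC; congr (_ * _).
rewrite derive_mx; last exact: diff_derivable.
by rewrite mxE.
Qed.

Lemma is_derive_line (x v : 'cV[R]_q) (s : R) :
  is_derive s 1 (fun s => G (x + s *: v)) (jacobian_mx G (x + s *: v) *m v).
Proof.
have E : (fun h : R => h^-1 *: (G (x + (h *: 1 + s) *: v) - G (x + s *: v))) =
    (fun h => h^-1 *: (G (h *: v + (x + s *: v)) - G (x + s *: v))).
  apply/funext => h; congr (_ *: (G _ - _)).
  by rewrite scalerDl [h *: 1]mulr1 addrCA.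
apply: DeriveDef; first by rewrite /derivable E; exact: diff_derivable.
by rewrite /derive E -derive_jacobian_mx.
Qed.

(** Mean value theorem for s |-> v^T Q G (x + s v) on [0, 1]: its derivative is
    half of the symmetrised form that the hypothesis bounds below. *)
Lemma monotone_increment (rho : R) :
  (forall x, mxge (Q *m jacobian_mx G x + (jacobian_mx G x)^T *m Q^T) rho%:M) ->
  forall x v, rho / 2 * dotmx v v <= dotmx v (Q *m (G (x + v) - G x)).
Proof.
move=> mG x v.
pose h s := dotmx (Q^T *m v) (G (x + s *: v)).
pose h' s := dotmx (Q^T *m v) (jacobian_mx G (x + s *: v) *m v).
have dh (s : R) : is_derive s 1 h (h' s).
  have -> : h = \sum_i (fun s => (Q^T *m v) i 0 * G (x + s *: v) i 0).
    by apply/funext => u; rewrite /h dotmxE fct_sumE.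
  rewrite /h' dotmxE; apply: is_derive_sum => i.
  by apply: is_deriveZ; apply: is_derive_entry; exact: is_derive_line.
have ch : {within `[0, 1], continuous h}.
  apply: derivable_within_continuous => s _.
  by have [] := dh s.
have [c _] := MVT_segment ler01 (fun s _ => dh s) ch.
rewrite subr0 mulr1 /h scale0r scale1r addr0.
have -> : dotmx v (Q *m (G (x + v) - G x)) =
    dotmx (Q^T *m v) (G (x + v)) - dotmx (Q^T *m v) (G x).
  by rewrite dotmx_mulmx dotmxDr dotmxNr.
move=> ->; rewrite /h' -dotmx_mulmx.
set J := jacobian_mx _ _.
have [_ /(_ v)] := mG (x + c *: v); rewrite -/J -mulmxA -/(dotmx _ _).
rewrite mulmxBl mul_scalar_mx mulmxDl dotmxDr dotmxNr dotmxZr dotmxDr.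
have -> : dotmx v (J^T *m Q^T *m v) = dotmx v (Q *m J *m v).
  by rewrite -trmx_mul dotmx_mulmx trmxK dotmxC.
rewrite mulmxA; lra.
Qed.

End monotone_map.

(** * Dynamics of the gain matrix *)

Section gain.
Variables (R : realType) (p : nat) (phi : R -> 'cV[R]_p).
Hypothesis hphi : piecewise_continuous phi.
Variables (alpha f0 beta0 M : R).
Hypotheses (alpha_gt0 : 0 < alpha) (f0_gt0 : 0 < f0) (beta0_gt0 : 0 < beta0).
Hypothesis (hM : 1 / f0 <= M).
Variables (F : R -> 'M[R]_p) (z : R -> R).
Let D := [set t | {for t, continuous phi}].
Let beta := beta_gain beta0 M F.
Hypotheses (F0 : F 0 = f0^-1%:M) (z0 : z 0 = 1).
Hypothesis dF : mpwderiv D F (fun t =>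
  - (alpha *: (F t *m phi t *m (phi t)^T *m F t)) + beta t *: F t).
Hypothesis dz : pwderiv D z (fun t => - (beta t * z t)).

Let cD : cofinite_times D. Proof. by case: hphi. Qed.

Let M_gt0 : 0 < M.
Proof. by apply: lt_le_trans hM; rewrite divr_gt0. Qed.

(** Since beta <= beta0, the function z^2 exp(2 beta0 t) is nondecreasing.  So
    z never vanishes, and being continuous it keeps its initial sign. *)
Lemma forgetting_gt0 t : 0 <= t -> 0 < z t.
Proof.
move=> t0.
have beta_le s : beta s <= beta0.
  rewrite /beta /beta_gain -[leRHS]mulr1 ler_wpM2l ?(ltW beta0_gt0)//.
  by rewrite gerBl divr_ge0 ?opnorm_ge0 ?ltW.
have nz s : 0 <= s -> z s != 0.
  move=> s0.
  have dg := pwderivM (pwderivM dz dz) (pwderiv_expR D (2 * beta0)).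
  have := pwderiv_ge0_le cD dg (lexx 0) s0.
  rewrite z0 mulr0 expR0 !mulr1 => /(_ _)/wrap[].
    move=> u _ _; rewrite mulrA -mulrDl mulr_ge0 ?expR_ge0//.
    have := beta_le u; have := sqr_ge0 (z u); rewrite expr2.
    move: (z u) (beta u) => a b a2 b0.
    have := mulr_ge0 a2 (_ : 0 <= beta0 - b); rewrite subr_ge0 => /(_ b0).
    by move=> ?; lra.
  by move=> h; apply/eqP => zs; move: h; rewrite zs !mul0r lt_geF.
rewrite ltNge; apply/negP => zt.
have cz : {within `[0, t], continuous z}.
  by apply: continuous_subspaceW (dz.1); exact: subset_itvl.
have zmm : Num.min (z 0) (z t) <= 0 <= Num.max (z 0) (z t).
  by rewrite z0 ge_min le_max zt ler01 orbT.
have [c + zc] := IVT t0 cz zmm; rewrite in_itv/= => /andP[c0 _].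
by have := nz c c0; rewrite zc eqxx.
Qed.

Let phib i : locally_bounded (fun t => phi t i 0).
Proof.
move=> T; have [C hC] := piecewise_continuous_bounded T hphi.
by exists C => t tT; rewrite (le_trans (normr_entry_le_mx_norm _ _ _))// hC.
Qed.

Let dzinv : pwderiv D (fun t => (z t)^-1) (fun t => beta t / z t).
Proof.
have [cz dz'] := dz; split.
  apply/continuous_within_itvcyP; move/continuous_within_itvcyP: cz => [cz c0].
  split; last by apply: cvgV => //; rewrite z0 oner_neq0.
  move=> t; rewrite in_itv/= andbT => t0; apply: cvgV.
    by rewrite gt_eqF// forgetting_gt0// ltW.
  by apply: cz; rewrite in_itv/= t0.
move=> t t0 Dt; have zt : z t != 0 by rewrite gt_eqF// forgetting_gt0// ltW.
apply: is_derive_eq (is_deriveV zt (dz' t t0 Dt)) _.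
by rewrite /GRing.scale/=; field.
Qed.

Let phi_cont i t : D t -> {for t, continuous (fun t => phi t i 0)}.
Proof.
move=> Dt; apply: (@continuous_comp _ _ _ phi (fun u : 'cV[R]_p => u i 0)) => //.
exact: coord_continuous.
Qed.

(** The information matrix of phi with weight g: [g = 1] is the matrix of the
    excitation condition and [g = 1 / z] is the one that inverts the gain. *)
Definition info_mx (g : R -> R) t : 'M[R]_p :=
  mx_integral (fun s => g s *: (phi s *m (phi s)^T)) 0 t.

Lemma mpwderiv_info_mx g g' : pwderiv D g g' ->
  mpwderiv D (info_mx g) (fun t => g t *: (phi t *m (phi t)^T)).
Proof.
move=> dg i j.
have E t : (g t *: (phi t *m (phi t)^T)) i j = g t * (phi t i 0 * phi t j 0).
  by rewrite !mxE big_ord1 mxE.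
apply: pwderiv_eq (@pwderiv_integral R D cD
  (fun t => (g t *: (phi t *m (phi t)^T)) i j) _ _) => [t|//|t t0 Dt|].
- by rewrite mxE.
- rewrite (_ : (fun _ => _) = fun t => g t * (phi t i 0 * phi t j 0)); last first.
    exact/funext.
  apply: cvgM.
    apply: differentiable_continuous; apply/derivable1_diffP.
    by have [] := dg.2 t t0 Dt.
  by apply: cvgM; exact: phi_cont.
- move=> T; have gb := pwderiv_bounded dg.
  have [C hC] := locally_boundedM gb (locally_boundedM (phib i) (phib j)) T.
  by exists C => t tT; rewrite E hC.
Qed.

Lemma info_mx0 g : info_mx g 0 = 0.
Proof. by apply/matrixP => i j; rewrite !mxE set_itv1 Rintegral_set1. Qed.

Lemma info_mx_sym g t : (info_mx g t)^T = info_mx g t.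
Proof.
apply/matrixP => i j; rewrite !mxE; congr Rintegral; apply/funext => s.
by rewrite !mxE; congr (_ * _); apply: eq_bigr => k _; rewrite !mxE mulrC.
Qed.

Lemma pwderiv_info_form g g' x : pwderiv D g g' ->
  pwderiv D (fun t => dotmx x (info_mx g t *m x))
            (fun t => g t * dotmx (phi t) x ^+ 2).
Proof.
move=> dg.
have := mpwderivM (mpwderivM (mpwderiv_cst D x^T) (mpwderiv_info_mx dg))
  (mpwderiv_cst D x).
move=> /(_ 0 0); apply: pwderiv_eq => [t|t _ _]; first by rewrite /dotmx mulmxA.
rewrite mul0mx add0r mulmx0 addr0 -mulmxA -/(dotmx _ _) -scalemxAl dotmxZr.
by rewrite -mulmxA dotmx_mulmx dotmxE big_ord1 -/(dotmx _ _) -expr2.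
Qed.

Definition scaled_gain t := z t *: F t.
(** The explicit inverse N of the matrix H given by [scaled_gain]. *)
Definition scaled_info t := f0%:M + alpha *: info_mx (fun s => (z s)^-1) t.

Lemma scaled_info_form t x : dotmx x (scaled_info t *m x) =
  f0 * dotmx x x + alpha * dotmx x (info_mx (fun s => (z s)^-1) t *m x).
Proof.
by rewrite /scaled_info mulmxDl mul_scalar_mx dotmxDr dotmxZr -scalemxAl dotmxZr.
Qed.

Lemma scaled_info_form_mono s t x : 0 <= s -> s <= t ->
  dotmx x (scaled_info s *m x) <= dotmx x (scaled_info t *m x).
Proof.
move=> s0 st; rewrite !scaled_info_form lerD2l ler_wpM2l ?(ltW alpha_gt0)//.
apply: (pwderiv_ge0_le cD (pwderiv_info_form x dzinv) s0 st) => u /andP[su _] _.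
rewrite mulr_ge0 ?sqr_ge0// invr_ge0 ltW// forgetting_gt0//.
by rewrite ltW// (le_lt_trans s0).
Qed.

Lemma scaled_info_form_ge t x : 0 <= t ->
  f0 * dotmx x x <= dotmx x (scaled_info t *m x).
Proof.
move=> t0; apply: le_trans (scaled_info_form_mono x (lexx 0) t0).
by rewrite scaled_info_form info_mx0 mul0mx dotmx0r mulr0 addr0.
Qed.

Lemma scaled_info_sym t : (scaled_info t)^T = scaled_info t.
Proof. by rewrite /scaled_info linearD/= tr_scalar_mx linearZ/= info_mx_sym. Qed.

Let B t := - alpha *: (F t *m phi t *m (phi t)^T).

Let Bb i j : locally_bounded (fun t => B t i j).
Proof.
have -> : (fun t => B t i j) =
    (fun t => - alpha * (F t *m phi t *m (phi t)^T) i j).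
  by apply/funext => t; rewrite mxE.
apply: locally_boundedM; first exact: locally_bounded_cst.
apply: locally_bounded_mulmx => k l.
- apply: locally_bounded_mulmx => a b; first exact: pwderiv_bounded (dF a b).
  rewrite (ord1 b); exact: phib.
- rewrite (ord1 k) (_ : (fun _ => _) = fun t => phi t l 0); first exact: phib.
  by apply/funext => t; rewrite mxE.
Qed.

(** The equation w' = - alpha F phi phi^T w is shared by the defect of the
    inverse and by the estimation error of eta. *)
Lemma gain_ode_eq0 m (w : R -> 'M[R]_(p, m)) :
  mpwderiv D w (fun t => - (alpha *: (F t *m phi t *m (phi t)^T *m w t))) ->
  w 0 = 0 -> forall t, 0 <= t -> w t = 0.
Proof.
move=> dw; apply: (linear_ode_eq0 cD Bb).
by apply: mpwderiv_eq dw => // t _ _; rewrite /B -scalemxAl scaleNr.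
Qed.

(** The forgetting terms of F and z cancel in the product. *)
Lemma mpwderiv_scaled_gain : mpwderiv D scaled_gain
  (fun t => - (alpha *: (F t *m phi t *m (phi t)^T *m scaled_gain t))).
Proof.
apply: mpwderiv_eq (mpwderivZ dz dF) => // t _ _.
rewrite /scaled_gain scalerDr scaleNr (scalerA _ (beta t)) (mulrC (z t)) addrC addrK.
by rewrite scalerN -scalemxAr !scalerA mulrC.
Qed.

Lemma scaled_gain_infoE t : 0 <= t -> scaled_gain t *m scaled_info t = 1%:M.
Proof.
move=> t0; apply/eqP; rewrite eq_sym -subr_eq0; apply/eqP; move: t t0.
apply: gain_ode_eq0; last first.
  rewrite /scaled_gain /scaled_info info_mx0 z0 scale1r scaler0 addr0 F0.
  by rewrite -scalar_mxM mulVf ?gt_eqF// subrr.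
have dN : mpwderiv D scaled_info
    (fun t => alpha *: ((z t)^-1 *: (phi t *m (phi t)^T))).
  have := mpwderivD (mpwderiv_cst D f0%:M)
    (mpwderivZ (pwderiv_cst D alpha) (mpwderiv_info_mx dzinv)).
  by apply: mpwderiv_eq => // t _ _; rewrite add0r scale0r add0r.
have := mpwderivD (mpwderiv_cst D 1%:M)
  (mpwderivN (mpwderivM mpwderiv_scaled_gain dN)).
apply: mpwderiv_eq => // t t_gt0 _.
rewrite add0r opprD mulNmx opprK -scalemxAl mulmxBr mulmx1 scalerBr opprB.
rewrite !mulmxA; congr (_ - _).
have zt : z t != 0 by rewrite gt_eqF// forgetting_gt0// ltW.
rewrite /scaled_gain -!scalemxAr -!scalemxAl !scalerA mulmxA; congr (_ *: _).
by field.
Qed.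

Lemma scaled_info_gainE t : 0 <= t -> scaled_info t *m scaled_gain t = 1%:M.
Proof. by move=> /scaled_gain_infoE/mulmx1C. Qed.

Lemma scaled_info_psd t x : 0 <= t -> 0 <= dotmx x (scaled_info t *m x).
Proof.
move=> t0; apply: le_trans (scaled_info_form_ge x t0).
by rewrite mulr_ge0 ?dotmx_ge0 ?ltW.
Qed.

(** The form of N is nondecreasing in time, so its coercivity constant
    1 / ||H s|| at time s is still valid at time t. *)
Lemma opnorm_scaled_gain_nincr s t : 0 <= s -> s <= t ->
  opnorm (scaled_gain t) <= opnorm (scaled_gain s).
Proof.
move=> s0 st; have t0 := le_trans s0 st.
apply: opnorm_le; first exact: opnorm_ge0.
apply: coercive_inv_enorm_le (scaled_info_gainE t0); first exact: opnorm_ge0.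
move=> x; have := sqnorm_le_opnorm_inv_form x (scaled_info_sym s)
  (fun x => scaled_info_psd x s0) (scaled_info_gainE s0).
move=> /le_trans; apply; rewrite ler_wpM2l ?opnorm_ge0//.
exact: scaled_info_form_mono.
Qed.

(** Let h be the norm of H at the final time t.  As
    beta z = beta0 (z - ||H|| / M) and ||H|| >= h before t, the function
    (z - h / M) exp(beta0 s) is nondecreasing on [0, t]; it starts at
    1 - h / M >= 1 - 1 / (f0 M) >= 0.  The constant h replaces ||H s||, which
    need not be differentiable. *)
Lemma opnorm_scaled_gain_le t : 0 <= t -> opnorm (scaled_gain t) <= M * z t.
Proof.
move=> t0; set h := opnorm (scaled_gain t).
have dg := pwderivM (pwderivD dz (pwderiv_cst D (- (h / M)))) (pwderiv_expR D beta0).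
have hM1 : h / M <= 1.
  rewrite ler_pdivrMr// mul1r (le_trans (opnorm_scaled_gain_nincr (lexx 0) t0))//.
  apply: le_trans hM; rewrite /scaled_gain z0 scale1r F0 mul1r.
  apply: opnorm_le => [|x]; first by rewrite invr_ge0 ltW.
  by rewrite mul_scalar_mx enormZ gtr0_norm// invr_gt0.
suff : 0 <= (z t - h / M) * expR (beta0 * t).
  by rewrite pmulr_lge0 ?expR_gt0// subr_ge0 ler_pdivrMr// mulrC.
apply: le_trans (pwderiv_ge0_le cD dg (lexx 0) t0 _).
  by rewrite z0 mulr0 expR0 mulr1 subr_ge0.
move=> s /andP[s0 st] _ /=; rewrite addr0 mulrA -mulrDl mulr_ge0 ?expR_ge0//.
have : h <= opnorm (scaled_gain s) by apply: opnorm_scaled_gain_nincr; exact: ltW.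
rewrite /scaled_gain opnormZ; last by rewrite forgetting_gt0// ltW.
rewrite /beta /beta_gain => hs.
have -> : - (beta0 * (1 - opnorm (F s) / M) * z s) + (z s - h / M) * beta0 =
  beta0 / M * (z s * opnorm (F s) - h) by field; rewrite gt_eqF.
by rewrite mulr_ge0 ?divr_ge0 ?subr_ge0// ltW.
Qed.

Lemma opnorm_gain_leM t : 0 <= t -> opnorm (F t) <= M.
Proof.
move=> t0; have zt := forgetting_gt0 t0; have := opnorm_scaled_gain_le t0.
by rewrite /scaled_gain opnormZ// mulrC ler_pM2r.
Qed.

Lemma beta_gain_itv t : 0 <= t -> 0 <= beta t <= beta0.
Proof.
move=> t0; rewrite /beta /beta_gain mulr_ge0 ?(ltW beta0_gt0)//=; last first.
  by rewrite subr_ge0 ler_pdivrMr// mul1r opnorm_gain_leM.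
rewrite -[leRHS]mulr1 ler_wpM2l ?(ltW beta0_gt0)//.
by rewrite gerBl divr_ge0 ?opnorm_ge0 ?ltW.
Qed.

Lemma forgetting_le1 t : 0 <= t -> z t <= 1.
Proof.
move=> t0; rewrite -z0; apply: (pwderiv_le0_ge cD dz (lexx 0) t0).
move=> s /andP[/ltW s0 _] _; rewrite oppr_le0 mulr_ge0//.
  by case/andP: (beta_gain_itv s0).
by rewrite ltW// forgetting_gt0.
Qed.

(** As 1 / z >= 1, the information weighted by 1 / z dominates the excitation
    integral at tc, and it keeps growing afterwards. *)
Lemma scaled_info_excited (Cc tc : R) : 0 < tc ->
  mxge (mx_integral (fun s => phi s *m (phi s)^T) 0 tc) Cc%:M ->
  forall t x, tc <= t ->
    (f0 + alpha * Cc) * dotmx x x <= dotmx x (scaled_info t *m x).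
Proof.
move=> tc0 [_ exc] t x tct.
apply: le_trans (scaled_info_form_mono x (ltW tc0) tct).
rewrite scaled_info_form mulrDl lerD2l -mulrA ler_wpM2l ?(ltW alpha_gt0)//.
have := exc x; rewrite -mulmxA -/(dotmx _ _) mulmxBl mul_scalar_mx dotmxDr dotmxNr.
rewrite dotmxZr subr_ge0 => /le_trans; apply.
have -> : mx_integral (fun s => phi s *m (phi s)^T) 0 tc = info_mx (fun=> 1) tc.
  rewrite /info_mx; congr mx_integral; apply/funext => s.
  by rewrite scale1r.
have dW := pwderivD (pwderiv_info_form x dzinv)
  (pwderivN (pwderiv_info_form x (pwderiv_cst D 1))).
have := pwderiv_ge0_le cD dW (lexx 0) (ltW tc0).
rewrite !info_mx0 subrr subr_ge0; apply => s /andP[/ltW s0 _] _.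
rewrite -mulrBl mulr_ge0 ?sqr_ge0// subr_ge0 invf_ge1 ?forgetting_gt0//.
exact: forgetting_le1.
Qed.

(** For t >= tc the matrix f0 H has norm at most f0 / (f0 + alpha Cc) < 1, so
    I - f0 H satisfies the hypothesis of [det_bounded_below_ge] with a constant
    that does not depend on t. *)
Lemma Delta_excited (Cc tc : R) : 0 < Cc -> 0 < tc ->
  mxge (mx_integral (fun s => phi s *m (phi s)^T) 0 tc) Cc%:M ->
  exists2 delta : R, 0 < delta &
    forall t, tc <= t -> delta <= `|Delta_sig f0 z F t|.
Proof.
move=> Cc0 tc0 exc; set n0 := f0 + alpha * Cc.
have n0f0 : f0 < n0 by rewrite ltrDl mulr_gt0.
have n0_gt0 : 0 < n0 by exact: lt_trans n0f0.
set k := 1 - f0 / n0.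
have k0 : 0 < k by rewrite subr_gt0 ltr_pdivrMr// mul1r.
exists (k ^+ p / p`!%:R) => [|t tct].
  by rewrite divr_gt0 ?exprn_gt0 ?ltr0n ?fact_gt0.
have t0 : 0 <= t by exact: le_trans (ltW tc0) tct.
apply: det_bounded_below_ge => // x.
rewrite mulmxBl mul1mx (mulrC (z t)) -scalerA -/(scaled_gain t) -scalemxAl.
have Hx : enorm (scaled_gain t *m x) <= n0^-1 * enorm x.
  apply: coercive_inv_enorm_le (scaled_info_gainE t0) _.
    by rewrite invr_ge0 ltW.
  by move=> u; rewrite ler_pdivlMl//; exact: (scaled_info_excited tc0 exc u tct).
have := enormD (x - f0 *: (scaled_gain t *m x)) (f0 *: (scaled_gain t *m x)).
rewrite subrK enormZ gtr0_norm//.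
have := ler_wpM2l (ltW f0_gt0) Hx.
rewrite /k mulrBl mul1r mulrA; lra.
Qed.

Variables (etah : R -> 'cV[R]_p) (eta eta0 : 'cV[R]_p) (y : R -> R).
Hypothesis etah0 : etah 0 = eta0.
Hypothesis hy : forall t, 0 <= t -> y t = ((phi t)^T *m eta) 0 0.
Hypothesis detah : mpwderiv D etah (fun t =>
  alpha *: (F t *m phi t *m ((y t)%:M - (phi t)^T *m etah t))).

(** The least-squares error, from its initial value eta0 - eta, is transported
    by f0 H: both sides solve the same linear equation. *)
Lemma etahE t : 0 <= t -> etah t = eta + f0 *: (scaled_gain t *m (eta0 - eta)).
Proof.
move=> t0; apply/eqP; rewrite -subr_eq0; apply/eqP; move: t t0.
apply: gain_ode_eq0; last first.
  rewrite etah0 /scaled_gain z0 scale1r F0 mul_scalar_mx scalerA divff ?gt_eqF//.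
  by rewrite scale1r addrCA addrN addr0 subrr.
have := mpwderivD detah (mpwderivN (mpwderivD (mpwderiv_cst D eta)
  (mpwderivZ (pwderiv_cst D f0)
     (mpwderivM mpwderiv_scaled_gain (mpwderiv_cst D (eta0 - eta)))))).
apply: mpwderiv_eq => // t t_gt0 _.
rewrite add0r scale0r add0r mulmx0 addr0.
have -> : (y t)%:M - (phi t)^T *m etah t = (phi t)^T *m (eta - etah t).
  rewrite mulmxBr; congr (_ - _); apply/matrixP => i j.
  by rewrite !ord1 mxE eqxx mulr1n hy// ltW.
rewrite [F t *m _ *m _]mulmxA !mulNmx -(scalemxAl alpha).
rewrite -[_ *m scaled_gain t *m _]mulmxA.
set K := F t *m phi t *m (phi t)^T; set v := scaled_gain t *m _.
rewrite !(mulmxBr, mulmxDr) -scalemxAr.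
move: (K *m eta) (K *m etah t) (K *m v) => a b c.
by apply/matrixP => i j; rewrite !mxE; ring.
Qed.

(** By [etahE], the vector to which the adjugate is applied is
    (I - z f0 F) eta; the product with the adjugate is then the determinant. *)
Lemma Y_sig_regression t : 0 <= t ->
  Y_sig f0 eta0 z F etah t = Delta_sig f0 z F t *: eta.
Proof.
move=> t0; rewrite /Y_sig /Delta_sig etahE//.
set A := 1%:M - (z t * f0) *: F t.
have -> : eta + f0 *: (scaled_gain t *m (eta0 - eta)) - (z t * f0) *: (F t *m eta0) =
    A *m eta.
  rewrite /A mulmxBl mul1mx mulmxBr /scaled_gain -!scalemxAl.
  move: (F t *m eta0) (F t *m eta) => a b.
  by apply/matrixP => i j; rewrite !mxE; ring.
by rewrite mulmxA mul_adj_mx mul_scalar_mx.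
Qed.

End gain.

(** * Exponential decay *)

Lemma bounded_signal_le (R : realType) (W : normedModType R) (f : R -> W) (C : R) :
  (forall t, 0 <= t -> `|f t| <= C) -> bounded_signal f.
Proof.
move=> fC; exists C; split=> [|x Cx t /=]; first exact: num_real.
by rewrite in_itv/= andbT => /fC/le_trans; apply; exact: ltW.
Qed.

Lemma enorm_bounded_signal (R : realType) n (f : R -> 'cV[R]_n) (C : R) :
  (forall t, 0 <= t -> enorm (f t) <= C) -> bounded_signal f.
Proof.
move=> fC; apply: (@bounded_signal_le _ _ _ C) => t t0.
apply: mx_norm_le_entry => [|i j].
  by rewrite (le_trans _ (fC t t0))// enorm_ge0.
by rewrite (ord1 j) (le_trans (normr_entry_le_enorm _ _))// fC.
Qed.

(** Before tc the function only fails to increase; the factor exp(lam tc) pays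
    for the decay missed on that interval. *)
Lemma pwderiv_exp_decay (R : realType) (D : set R) (V V' : R -> R) (tc lam : R) :
  cofinite_times D -> pwderiv D V V' -> 0 <= tc -> 0 <= lam ->
  (forall t, 0 <= V t) ->
  (forall t, 0 < t -> D t -> V' t <= 0) ->
  (forall t, tc < t -> D t -> V' t <= - lam * V t) ->
  forall t, 0 <= t -> V t <= V 0 * expR (lam * tc) * expR (- lam * t).
Proof.
move=> cD dV tc0 lam0 V0 V'0 V'lam t t0.
have V_le s : 0 <= s -> V s <= V 0.
  move=> s0; apply: (pwderiv_le0_ge cD dV (lexx 0) s0) => u /andP[u0 _].
  exact: V'0.
have [ttc|/ltW tct] := leP t tc.
  rewrite -mulrA -expRD -[leLHS]mulr1 ler_pM// ?V_le//.
  by rewrite -expR0 ler_expR mulNr subr_ge0 ler_wpM2l.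
rewrite [- lam * t]mulNr expRN ler_pdivlMr ?expR_gt0//.
have dg := pwderivM dV (pwderiv_expR D lam).
apply: (@le_trans _ _ (V tc * expR (lam * tc))); last first.
  by rewrite ler_wpM2r ?expR_ge0 ?V_le.
apply: (pwderiv_le0_ge cD dg tc0 tct) => s /andP[tcs _] Ds.
rewrite mulrA -mulrDl pmulr_lle0 ?expR_gt0//.
by have := V'lam s tcs Ds; lra.
Qed.

Theorem proposition1 (R : realType) (p q : nat) (hqp : (q <= p)%N)
  (G : 'cV[R]_q -> 'cV[R]_p) (hG : smooth G)
  (Q : 'M[R]_(q, p)) (hA1 : monotonicity G Q)
  (phi : R -> 'cV[R]_p) (hphi : piecewise_continuous phi)
  (hA2 : interval_excitation phi)
  (theta : 'cV[R]_q) (y : R -> R)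
  (hy : forall t : R, 0 <= t -> y t = ((phi t)^T *m G theta) 0 0)
  (alpha f0 beta0 M gamma : R)
  (halpha : 0 < alpha) (hf0 : 0 < f0) (hbeta0 : 0 < beta0)
  (hM : 1 / f0 <= M) (hgamma : 0 < gamma)
  (eta0 : 'cV[R]_p) (theta0 : 'cV[R]_q)
  (etah : R -> 'cV[R]_p) (F : R -> 'M[R]_p) (thetah : R -> 'cV[R]_q)
  (z : R -> R)
  (hest : estimator_trajectory G Q phi y alpha f0 beta0 M gamma eta0 theta0
            etah F thetah z) :
  (exists c lam : R, [/\ 0 < c, 0 < lam &
     forall t : R, 0 <= t -> enorm (thetah t - theta) <= c * expR (- lam * t)])
  /\
  [/\ bounded_signal etah, bounded_signal F, bounded_signal thetah &
      bounded_signal z] /\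
  [/\ bounded_signal (beta_gain beta0 M F),
      bounded_signal (Delta_sig f0 z F) &
      bounded_signal (Y_sig f0 eta0 z F etah)].
Proof.
case: hest => [[etah0 cetah odeetah] [F0 cF odeF] [_ cth odeth] [z0 cz odez]].
pose D := [set t | {for t, continuous phi}].
have cD : cofinite_times D by case: hphi.
have detah := continuous_mpwderiv cetah odeetah.
have dF := continuous_mpwderiv cF odeF.
have dth := continuous_mpwderiv cth odeth.
have dz : pwderiv D z (fun t => - (beta_gain beta0 M F t * z t)) by [].
have zgt0 := forgetting_gt0 hphi hf0 hbeta0 hM z0 dz.
have z_le1 := forgetting_le1 hphi halpha hf0 hbeta0 hM F0 z0 dF dz.
have FM := opnorm_gain_leM hphi halpha hf0 hbeta0 hM F0 z0 dF dz.
have HM t : 0 <= t -> opnorm (scaled_gain F z t) <= M.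
  move=> t0; rewrite /scaled_gain opnormZ ?zgt0// -[leRHS]mul1r.
  by rewrite ler_pM ?opnorm_ge0 ?z_le1 ?FM// ltW// zgt0.
have M0 : 0 < M by rewrite (lt_le_trans _ hM)// divr_gt0.
have YE t : 0 <= t ->
    Y_sig f0 eta0 z F etah t = Delta_sig f0 z F t *: G theta.
  exact: (Y_sig_regression hphi hf0 F0 z0 dF dz etah0 hy detah).
have etE t : 0 <= t ->
    etah t = G theta + f0 *: (scaled_gain F z t *m (eta0 - G theta)).
  exact: (etahE hphi hf0 F0 z0 dF dz etah0 hy detah).
have [C DeltaC] : exists C, forall t, 0 <= t -> `|Delta_sig f0 z F t| <= C.
  exists (p`!%:R * (1 + f0 * M) ^+ p) => t t0; apply: normr_det_le => i j.
  rewrite !mxE (le_trans (ler_normB _ _))// lerD//.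
    by case: (i == j); rewrite ?normr1 ?normr0 ?ler01.
  rewrite -mulrA mulrCA normrM gtr0_norm// ler_wpM2l ?(ltW hf0)//.
  have := normr_entry_le_opnorm (scaled_gain F z t) i j.
  by rewrite mxE => /le_trans; apply; exact: HM.
have [c [lam [c0 lam0 decay]]] : exists c lam : R, [/\ 0 < c, 0 < lam &
    forall t, 0 <= t -> enorm (thetah t - theta) <= c * expR (- lam * t)].
  have [rho rho0 mono] := hA1; have [Cc [tc [Cc0 tc0 exc]]] := hA2.
  have [delta delta0 Deltadelta] :=
    Delta_excited hphi halpha hf0 hbeta0 hM F0 z0 dF dz Cc0 tc0 exc.
  have dG : forall x, differentiable G x by case: (hG 1%N).
  have incr := monotone_increment dG mono.
  pose w t := thetah t - theta.
  pose Dl := Delta_sig f0 z F.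
  have dw : mpwderiv D w (fun t =>
      - (gamma * Dl t ^+ 2) *: (Q *m (G (theta + w t) - G theta))).
    (* the regression turns the innovation Y - Delta G(thetah) into
       Delta (G(theta) - G(thetah)) *)
    have := mpwderivD dth (mpwderivN (mpwderiv_cst D theta)).
    apply: mpwderiv_eq => // t /ltW t_ge0 _.
    rewrite YE// subr0 /w (addrC theta) subrK -/(Dl t) -scalerBr -!scalemxAr !scalerA.
    by rewrite -[G theta - _]opprB mulmxN scalerN scaleNr expr2 ?mulrA.
  have dV := pwderiv_sqnorm dw.
  have V' t : 2 * dotmx (w t)
      (- (gamma * Dl t ^+ 2) *: (Q *m (G (theta + w t) - G theta))) <=
      - (gamma * rho * Dl t ^+ 2) * dotmx (w t) (w t).
    rewrite dotmxZr; have g0 : 0 <= gamma * Dl t ^+ 2.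
      by rewrite mulr_ge0 ?sqr_ge0// ltW.
    by have := ler_wpM2l g0 (incr theta (w t)); lra.
  set lam := gamma * rho * delta ^+ 2.
  have lam0 : 0 < lam by rewrite !mulr_gt0 ?exprn_gt0.
  have Vdecay := pwderiv_exp_decay cD dV (ltW tc0) (ltW lam0)
    (fun t => dotmx_ge0 _) _ _.
  (* half the rate for the norm, which is a square root; adding 1 keeps the
     constant positive when the initial error is 0 *)
  exists ((enorm (w 0) + 1) * expR (lam / 2 * tc)), (lam / 2); split.
  - by rewrite mulr_gt0 ?expR_gt0// ltr_wpDl ?enorm_ge0.
  - by rewrite divr_gt0.
  move=> t t0; apply: enorm_le.
    by rewrite !mulr_ge0 ?expR_ge0// addr_ge0 ?enorm_ge0.
  apply: (@le_trans _ _ (dotmx (w 0) (w 0) * expR (lam * tc) * expR (- lam * t))).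
    apply: Vdecay => // s s0 _; apply: le_trans (V' s) _.
      rewrite mulNr oppr_le0 mulr_ge0 ?dotmx_ge0//.
      by rewrite mulr_ge0 ?sqr_ge0// ltW// mulr_gt0.
    rewrite ler_wpM2r ?dotmx_ge0// lerN2 ler_pM2l ?mulr_gt0//.
    rewrite -[leRHS]real_normK ?num_real// ler_sqr ?nnegrE ?(ltW delta0)//.
    by apply: Deltadelta; exact: ltW.
  rewrite !exprMn -!expRM_natl !mulr_natl.
  rewrite -enorm_sqr.
  have -> : lam / 2 * tc *+ 2 = lam * tc by rewrite mulr2n; field.
  have -> : - (lam / 2) * t *+ 2 = - lam * t by rewrite mulr2n; field.
  rewrite ler_pM2r ?expR_gt0// ler_pM2r ?expR_gt0//.
  by rewrite ler_sqr ?nnegrE ?addr_ge0 ?enorm_ge0// lerDl.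
split; first by exists c, lam.
split; split.
- apply: (@enorm_bounded_signal _ _ _
    (enorm (G theta) + f0 * (M * enorm (eta0 - G theta)))) => t t0.
  rewrite etE// (le_trans (enormD _ _))// lerD2l enormZ gtr0_norm//.
  rewrite ler_wpM2l ?(ltW hf0)// (le_trans (mulmx_opnorm_le _ _))//.
  by rewrite ler_wpM2r ?enorm_ge0// HM.
- apply: (@bounded_signal_le _ _ _ M) => t t0.
  apply: mx_norm_le_entry => [|i j]; first exact: ltW.
  by rewrite (le_trans (normr_entry_le_opnorm _ _ _))// FM.
- apply: (@enorm_bounded_signal _ _ _ (c + enorm theta)) => t t0.
  rewrite -[thetah t](subrK theta) (le_trans (enormD _ _))// lerD2r.
  rewrite (le_trans (decay t t0))// -[leRHS]mulr1 ler_wpM2l ?(ltW c0)//.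
  by rewrite -expR0 ler_expR mulNr oppr_le0 mulr_ge0// ltW.
- apply: (@bounded_signal_le _ _ _ 1) => t t0.
  by rewrite gtr0_norm ?zgt0// z_le1.
- apply: (@bounded_signal_le _ _ _ beta0) => t t0.
  have /andP[b0 b1] :=
    beta_gain_itv hphi halpha hf0 hbeta0 hM F0 z0 dF dz t0.
  by rewrite ger0_norm.
- exact: (@bounded_signal_le _ _ _ C).
- apply: (@bounded_signal_le _ _ _ (C * `|G theta|)) => t t0.
  by rewrite YE// normrZ ler_wpM2r ?DeltaC.
Qed.
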